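(* Let $N=\{1,\dots,n\}$ be a set of jobs with first-stage processing times $p_1,\dots,p_n\ge 0$ and second-stage processing times $q_1,\dots,q_n\ge 0$, and let $M\subseteq N$. Define \[ f(M)=\min\Big\{\sum_{i\in N}\sum_{j\in N} p_j(n+1-i)x_{ij}+\sum_{i\in N}\sum_{j\in N} q_j(n+1-i)y_{ij}\ :\ \bm{x},\bm{y}\in\mathcal{X},\ x_{ij}=y_{ij}\ \forall i\in N,\ j\in M\Big\}. \] Compute the following: let $\bm{a}$ be the values $p_j$, $j\in N\setminus M$, sorted non-decreasingly; let $\bm{b}$ be the values $q_j$, $j\in N\setminus M$, sorted non-decreasingly; let $\bm{c}$ be the values $p_j+q_j$, $j\in M$; let $\bm{d}=\bm{a}+\bm{b}$ (componentwise sum of the two sorted vectors); and let $\bm{e}=(e_1,\dots,e_n)$ be the concatenation of $\bm{c}$ and $\bm{d}$ sorted non-decreasingly. Then \[ f(M)=\sum_{i=1}^{n}(n+1-i)e_i . \]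
   Context: $\mathcal{X}$ denotes the set of $n\times n$ permutation matrices, i.e. $\bm{x}\in\{0,1\}^{n\times n}$ with $\sum_{i\in N}x_{ij}=1$ for all $j\in N$ and $\sum_{j\in N}x_{ij}=1$ for all $i\in N$; $x_{ij}=1$ means job $j$ is scheduled in position $i$ of a single-machine schedule, so $\sum_{i,j}p_j(n+1-i)x_{ij}$ is the sum of completion times of that schedule. *)

(* Defs.v *)
From HB Require Import structures.
From mathcomp Require Import all_boot all_order all_algebra.
Set Implicit Arguments.
Unset Strict Implicit.
Unset Printing Implicit Defensive.
Import Order.TTheory GRing.Theory Num.Theory.
Local Open Scope ring_scope.

(* Jobs and positions are indexed from 0: the ordinal [i : 'I_n] stands for
   the position [i.+1], whose weight [n + 1 - i.+1] is written [n - i].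
   Rows of an assignment matrix are positions, columns are jobs. *)

Definition is_assignment (n : nat) (x : 'M[bool]_n) : bool :=
  [forall j, (\sum_i x i j == 1)%N] && [forall i, (\sum_j x i j == 1)%N].

Definition feasible (n : nat) (M : {set 'I_n})
    (xy : 'M[bool]_n * 'M[bool]_n) : bool :=
  [&& is_assignment xy.1, is_assignment xy.2
    & [forall i, forall j in M, xy.1 i j == xy.2 i j]].

Definition sum_completion (R : realDomainType) (n : nat) (p : 'I_n -> R)
    (x : 'M[bool]_n) : R :=
  \sum_(i < n) \sum_(j < n) p j * (n - i)%:R * (x i j)%:R.

Definition cost (R : realDomainType) (n : nat) (p q : 'I_n -> R)
    (xy : 'M[bool]_n * 'M[bool]_n) : R :=
  sum_completion p xy.1 + sum_completion q xy.2.

Definition id_assignment (n : nat) : 'M[bool]_n := \matrix_(i, j) (i == j).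

(* The pair of identity schedules only serves as the default element required
   by [arg min]; it is always feasible (see [feasible_id]), so that the value
   below is a genuine minimum (see [opt_valueP]). *)
Definition opt_value (R : realDomainType) (n : nat) (p q : 'I_n -> R)
    (M : {set 'I_n}) : R :=
  cost p q [arg min_(xy < (id_assignment n, id_assignment n) | feasible M xy)
              cost p q xy]%O.

Definition unshared_sorted (R : realDomainType) (n : nat) (p : 'I_n -> R)
    (M : {set 'I_n}) : seq R :=
  sort <=%R [seq p j | j <- enum (~: M)].

Definition shared_sums (R : realDomainType) (n : nat) (p q : 'I_n -> R)
    (M : {set 'I_n}) : seq R :=
  [seq p j + q j | j <- enum M].

(* The two zipped sequences have the same size, so nothing is truncated. *)
Definition unshared_sums (R : realDomainType) (n : nat) (p q : 'I_n -> R)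
    (M : {set 'I_n}) : seq R :=
  [seq ab.1 + ab.2 | ab <- zip (unshared_sorted p M) (unshared_sorted q M)].

Definition merged_sorted (R : realDomainType) (n : nat) (p q : 'I_n -> R)
    (M : {set 'I_n}) : seq R :=
  sort <=%R (shared_sums p q M ++ unshared_sums p q M).

Lemma is_assignment_id (n : nat) : is_assignment (id_assignment n).
Proof.
apply/andP; split; apply/forallP=> k; rewrite (bigD1 k) //= mxE eqxx.
  by rewrite big1 // => i /negPf ik; rewrite mxE ik.
by rewrite big1 // => i /negPf ik; rewrite mxE eq_sym ik.
Qed.

Lemma feasible_id (n : nat) (M : {set 'I_n}) :
  feasible M (id_assignment n, id_assignment n).
Proof.
rewrite /feasible /= is_assignment_id /=.
by apply/forallP=> i; apply/forall_inP=> j _; rewrite eqxx.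
Qed.

Lemma opt_valueP (R : realDomainType) (n : nat) (p q : 'I_n -> R)
    (M : {set 'I_n}) :
  (exists2 xy, feasible M xy & opt_value p q M = cost p q xy) /\
  (forall xy, feasible M xy -> opt_value p q M <= cost p q xy).
Proof.
rewrite /opt_value; case: arg_minP; first exact: feasible_id.
by move=> xy Fxy minxy; split=> //; exists xy.
Qed.

Lemma size_merged_sorted (R : realDomainType) (n : nat) (p q : 'I_n -> R)
    (M : {set 'I_n}) : size (merged_sorted p q M) = n.
Proof.
rewrite size_sort size_cat !size_map size_zip !size_sort !size_map minnn.
by rewrite -!cardE cardsC card_ord.
Qed.

(* Main.v *)
Require Import Defs.
From mathcomp Require Import all_boot all_order all_algebra.
From mathcomp Require Import ring lra.
Set Implicit Arguments.
Unset Strict Implicit.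
Unset Printing Implicit Defensive.
Import Order.TTheory GRing.Theory Num.Theory.
Local Open Scope ring_scope.

(** A pair of schedules amounts to two placements [s] and [t] of the jobs, of
    cost [\sum_j p_j w_(s j) + \sum_j q_j w_(t j)] with decreasing position
    weights [w].  Since [s] and [t] agree on [M], they also send the complement
    of [M] onto the same set of positions, so the rearrangement inequality,
    applied to [p] and [q] separately, allows both to be sorted on these
    positions: this pairs the jobs outside [M] into composite jobs of
    processing times [d].  A second use of the rearrangement inequality, on the
    concatenation of [c] and [d], gives the lower bound, and sorting the
    composite jobs yields a feasible pair attaining it. *)

(** * The rearrangement inequality for sequences *)

Section Rearrangement.

Variable R : realDomainType.
Implicit Types u v : seq R.

Definition dotseq u v : R := \sum_(ab <- zip u v) ab.1 * ab.2.

Lemma dotseq_cons a u b v : dotseq (a :: u) (b :: v) = a * b + dotseq u v.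
Proof. by rewrite /dotseq /= big_cons. Qed.

Lemma dotseq_cat u1 u2 v1 v2 : size u1 = size v1 ->
  dotseq (u1 ++ u2) (v1 ++ v2) = dotseq u1 v1 + dotseq u2 v2.
Proof. by move=> sz; rewrite /dotseq zip_cat // big_cat. Qed.

Lemma dotseq_map (T : Type) (F G : T -> R) (s : seq T) :
  dotseq (map F s) (map G s) = \sum_(x <- s) F x * G x.
Proof. by rewrite /dotseq zip_map big_map. Qed.

Lemma dotseqDl u1 u2 v : size u1 = size u2 ->
  dotseq [seq ab.1 + ab.2 | ab <- zip u1 u2] v = dotseq u1 v + dotseq u2 v.
Proof.
elim: u1 u2 v => [|a u1 IH] [|b u2] [|c v] //= sz; rewrite ?dotseq_cons.
- by rewrite /dotseq !big_nil addr0.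
- by rewrite /dotseq !big_nil addr0.
- by rewrite /dotseq !big_nil addr0.
- by rewrite IH; [ring | case: sz].
Qed.

Lemma dotseq_nth n (F : 'I_n -> R) u : size u = n ->
  \sum_(i < n) F i * u`_i = dotseq u (map F (enum 'I_n)).
Proof.
move=> sz; have {2}-> : u = [seq u`_(val i) | i <- enum 'I_n].
  by rewrite (map_comp (nth 0 u) val) val_enum_ord -sz -/(mkseq _ _) mkseq_nth.
by rewrite dotseq_map big_enum /=; apply: eq_bigr => i _; rewrite mulrC.
Qed.

(** The insertion moves [b] past one larger entry [c] at a time, and each such swap lowers the sum
    by [(a' - a) * (c - b)], which is nonnegative because [a :: u] is non-decreasing. Nothing is
    assumed about the order of [v]. *)
Lemma dotseq_insert_le a u b v : size u = size v -> sorted <=%R (a :: u) ->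
  dotseq (a :: u) (merge >=%R [:: b] v) <= dotseq (a :: u) (b :: v).
Proof.
elim: v a u => [|c v IH] a [|a' u] //= [sz] /andP[aa' u_sorted].
case: ifP => [//|/negbT]; rewrite -ltNge => bc.
have /= := IH a' u sz u_sorted; rewrite !dotseq_cons => IHu.
have : 0 <= (a' - a) * (c - b) by rewrite mulr_ge0 ?subr_ge0 // ltW.
move: (dotseq _ (merge _ _ _)) (dotseq u v) IHu => X Y IHu.
nra.
Qed.

(** Insertion sort: sorting the tail does not increase the sum by induction, and neither does
    inserting the head. *)
Lemma dotseq_sortr_le u v : size u = size v -> sorted <=%R u ->
  dotseq u (sort >=%R v) <= dotseq u v.
Proof.
elim: u v => [|a u IH] [|b v] // [sz] u_sorted.
(* [sort] is not defined by insertion, but a sorted permutation is unique for an antisymmetric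
   order. *)
have -> : sort >=%R (b :: v) = merge >=%R [:: b] (sort >=%R v).
  apply: (sorted_eq ge_trans ge_anti).
  - exact: (sort_sorted ge_total).
  - apply: (merge_sorted ge_total) => //; exact: (sort_sorted ge_total).
  - by rewrite perm_sort perm_sym perm_merge /= perm_cons perm_sort.
apply: le_trans (dotseq_insert_le _ _ _) _; rewrite ?size_sort //.
by rewrite !dotseq_cons lerD2l; apply: IH => //; apply: path_sorted u_sorted.
Qed.

Lemma rearrangement u v : size u = size v ->
  dotseq (sort <=%R u) (sort >=%R v) <= dotseq u v.
Proof.
move=> sz.
(* Sorting the pairs by first component permutes the terms of the sum, which reduces to the case of
   a sorted [u]. *)
pose z := sort (relpre fst <=%R) (zip u v).
have z_perm : perm_eq z (zip u v) by rewrite perm_sort.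
have -> : dotseq u v = dotseq (unzip1 z) (unzip2 z).
  by rewrite /dotseq zip_unzip; apply: perm_big; rewrite perm_sym.
have -> : sort <=%R u = unzip1 z.
  by rewrite /z /unzip1 -sort_map -/(unzip1 _) unzip1_zip ?sz.
have -> : sort >=%R v = sort >=%R (unzip2 z).
  apply/(perm_sortP ge_total ge_trans ge_anti).
  by rewrite -{1}(@unzip2_zip _ _ u v) ?sz // perm_sym perm_map.
apply: dotseq_sortr_le; first by rewrite !size_map.
by rewrite /z /unzip1 -sort_map sort_le_sorted.
Qed.

End Rearrangement.

Lemma map_index (T : eqType) (s : seq T) : uniq s ->
  map (index^~ s) s = iota 0 (size s).
Proof.
case: s => // x0 s s_uniq.
apply: (@eq_from_nth _ 0%N) => [|k]; rewrite size_map ?size_iota // => k_lt.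
by rewrite (nth_map x0) // nth_iota // index_uniq.
Qed.

(** * Assignment matrices as injective placements of jobs *)

Section Assignments.

Variables (R : realDomainType) (n : nat).
Implicit Types (x : 'M[bool]_n) (p q : 'I_n -> R) (M : {set 'I_n}).

Definition position_weight (i : 'I_n) : R := (n - i)%:R.

Definition position_weights : seq R := map position_weight (enum 'I_n).

Lemma size_position_weights : size position_weights = n.
Proof. by rewrite size_map size_enum_ord. Qed.

Lemma position_weights_sorted : sorted >=%R position_weights.
Proof.
rewrite /position_weights sorted_map.
have : sorted ltn (map val (enum 'I_n)) by rewrite val_enum_ord iota_ltn_sorted.
rewrite sorted_map; apply: sub_sorted => i j /= ij.
by rewrite ler_nat leq_sub2l // ltnW.
Qed.

(** The column sums give each job its position; the row sums forbid two jobs in one position. *)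
Lemma assignment_position x : is_assignment x ->
  exists2 s : 'I_n -> 'I_n, injective s & forall i j, x i j = (i == s j).
Proof.
(* The property of [i] is kept boolean so that [xchoose] can turn it into a function of the
   column. *)
have one_true (F : 'I_n -> bool) : (\sum_i F i == 1)%N ->
    exists i, [forall k, F k == (k == i)].
  move/sum_nat_eq1 => [i [_ Fi F0]]; exists i; apply/forallP=> k.
  have [->|ki] := eqVneq k i; first by move: Fi; case: (F i).
  by move: (F0 k ki isT); case: (F k).
case/andP=> /forallP cols /forallP rows.
pose s j := xchoose (one_true (x^~ j) (cols j)).
have xs i j : x i j = (i == s j).
  exact/eqP/(forallP (xchooseP (one_true (x^~ j) (cols j)))).
exists s => // j k sjk; have [l /forallP xl] := one_true _ (rows (s j)).
have /eqP : j == l by rewrite -(eqP (xl j)) xs eqxx.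
have /eqP -> : k == l by rewrite -(eqP (xl k)) xs sjk eqxx.
by [].
Qed.

Lemma position_assignment (s : 'I_n -> 'I_n) : injective s ->
  is_assignment (\matrix_(i, j) (i == s j)).
Proof.
move=> s_inj; have [r sK rK] := injF_bij s_inj.
apply/andP; split; apply/forallP=> k.
  rewrite (bigD1 (s k)) //= mxE eqxx big1 // => i /negPf ik.
  by rewrite mxE ik.
rewrite (bigD1 (r k)) //= mxE rK eqxx big1 // => j jk.
by rewrite mxE eq_sym (can2_eq sK rK) (negPf jk).
Qed.

Lemma sum_completion_position p x (s : 'I_n -> 'I_n) :
    (forall i j, x i j = (i == s j)) ->
  sum_completion p x = \sum_j p j * position_weight (s j).
Proof.
move=> xs; rewrite /sum_completion exchange_big; apply: eq_bigr => j _.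
rewrite (bigD1 (s j)) //= xs eqxx mulr1 big1 ?addr0 // => i /negPf ij.
by rewrite xs ij mulr0.
Qed.

(** * The lower bound on the cost of a feasible pair *)

Lemma perm_map_enum (s : 'I_n -> 'I_n) : injective s ->
  perm_eq (map s (enum 'I_n)) (enum 'I_n).
Proof.
move=> s_inj; have [r sK rK] := injF_bij s_inj.
apply: uniq_perm => [| |i].
- by rewrite map_inj_uniq // enum_uniq.
- exact: enum_uniq.
- by rewrite mem_enum; apply/mapP; exists (r i); rewrite ?mem_enum ?rK.
Qed.

Lemma perm_enum_setC M : perm_eq (enum M ++ enum (~: M)) (enum 'I_n).
Proof.
apply: uniq_perm; [|exact: enum_uniq|].
  rewrite cat_uniq !enum_uniq andbT -all_predC; apply/allP => j.
  by rewrite mem_enum inE /= mem_enum.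
by move=> j; rewrite mem_cat !mem_enum inE orbN.
Qed.

Lemma cost_ge p q M xy : feasible M xy ->
  dotseq (merged_sorted p q M) position_weights <= cost p q xy.
Proof.
case: xy => x y /and3P[/= /assignment_position[s s_inj xs]].
move=> /assignment_position[t t_inj yt] /forallP agree.
have st j : j \in M -> s j = t j.
  move=> jM; have /eqP := forall_inP (agree (s j)) j jM.
  by rewrite xs yt eqxx => /esym/eqP.
pose wM := [seq position_weight (s j) | j <- enum M].
pose wC (r : 'I_n -> 'I_n) := [seq position_weight (r j) | j <- enum (~: M)].
have perm_w : perm_eq (wM ++ wC s) position_weights.
  rewrite /wM /wC -map_cat (map_comp position_weight s); apply: perm_map.
  apply: perm_trans (perm_map_enum s_inj).
  by apply: perm_map; apply: perm_enum_setC.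
(* Both placements fill all positions and agree on [M]; cancelling the positions of [M] leaves the
   same ones for the other jobs. *)
have perm_wC : perm_eq (wC t) (wC s).
  rewrite /wC (map_comp _ t) (map_comp _ s); apply: perm_map.
  rewrite -(perm_cat2l (map s (enum M))).
  have {1}-> : map s (enum M) = map t (enum M).
    by apply/eq_in_map => j; rewrite mem_enum => /st.
  rewrite -!map_cat; apply: (perm_trans (perm_map _ (perm_enum_setC M))).
  apply: (perm_trans (perm_map_enum t_inj)).
  rewrite perm_sym; apply: (perm_trans (perm_map _ (perm_enum_setC M))).
  exact: perm_map_enum.
rewrite /cost (sum_completion_position _ xs) (sum_completion_position _ yt).
(* One decreasing list of weights serves both stages, so the two sorted vectors can be added
   componentwise. *)
pose U := sort >=%R (wC s).
have ge_unshared (f : 'I_n -> R) r : perm_eq (wC r) (wC s) ->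
    dotseq (unshared_sorted f M) U
      <= \sum_(j in ~: M) f j * position_weight (r j).
  move=> wr; rewrite -big_enum -(dotseq_map f (fun j => position_weight (r j))).
  have -> : U = sort >=%R (wC r).
    by apply/esym/(perm_sortP ge_total ge_trans ge_anti).
  by apply: rearrangement; rewrite !size_map.
have splitM (F : 'I_n -> R) :
    \sum_j F j = \sum_(j in M) F j + \sum_(j in ~: M) F j.
  rewrite (bigID [in M]) /=; congr (_ + _).
  by apply: eq_bigl => j; rewrite inE.
rewrite 2!splitM.
have -> : \sum_(j in M) q j * position_weight (t j) =
          \sum_(j in M) q j * position_weight (s j).
  by apply: eq_bigr => j /st ->.
rewrite addrACA -big_split /=.
have -> : \sum_(j in M) (p j * position_weight (s j) + q j * position_weight (s j))
          = dotseq (shared_sums p q M) wM.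
  by rewrite dotseq_map big_enum; apply: eq_bigr => j _; rewrite mulrDl.
apply: le_trans (lerD (lexx _) (lerD (ge_unshared p s (perm_refl _))
                                     (ge_unshared q t perm_wC))).
have sz : size (unshared_sorted p M) = size (unshared_sorted q M).
  by rewrite !size_sort !size_map.
rewrite -(dotseqDl _ sz) -/(unshared_sums p q M) -dotseq_cat ?size_map //.
(* The weights are already decreasing; writing them as a sort gives the shape required by
   [rearrangement]. *)
have -> : position_weights = sort >=%R (wM ++ U).
  rewrite -(sorted_sort ge_trans position_weights_sorted).
  apply/(perm_sortP ge_total ge_trans ge_anti).
  rewrite perm_sym; apply: perm_trans perm_w.
  by rewrite perm_cat2l perm_sort.
apply: rearrangement.
by rewrite !size_cat !size_map size_zip sz minnn !size_sort !size_map.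
Qed.

(** * Construction of a feasible pair attaining the bound *)

Lemma sum_index_weight p (js : seq 'I_n) : perm_eq js (enum 'I_n) ->
  \sum_j p j * (n - index j js)%:R = dotseq (map p js) position_weights.
Proof.
move=> js_enum; have js_uniq : uniq js by rewrite (perm_uniq js_enum) enum_uniq.
(* Summing in the order of [js] makes the indices run through 0, 1, 2, ..., hence the weights appear
   in order of position. *)
rewrite -big_enum -(perm_big _ js_enum) /=.
rewrite -(dotseq_map p (fun j => (n - index j js)%:R)); congr dotseq.
rewrite (map_comp (fun k => (n - k)%:R) (index^~ js)).
rewrite /position_weights (map_comp (fun k => (n - k)%:R) val) val_enum_ord.
by rewrite map_index // (perm_size js_enum) size_enum_ord.
Qed.

(** [index] stops at the first match, and by hypothesis both searches match at the same places. *)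
Lemma index_unzip (L : seq ('I_n * 'I_n)) j :
    {in L, forall ab, (ab.1 == j) = (ab.2 == j)} ->
  index j (unzip1 L) = index j (unzip2 L).
Proof.
elim: L => //= ab L IH eqL; rewrite eqL ?mem_head // IH // => cd cdL.
by apply: eqL; rewrite inE cdL orbT.
Qed.

(* The list [L] gives the jobs of both schedules in order of position. *)
Lemma feasible_of_pairs p q M (L : seq ('I_n * 'I_n)) :
    perm_eq (unzip1 L) (enum 'I_n) -> perm_eq (unzip2 L) (enum 'I_n) ->
    {in L & M, forall ab j, (ab.1 == j) = (ab.2 == j)} ->
  exists2 xy, feasible M xy
    & cost p q xy = dotseq [seq p ab.1 + q ab.2 | ab <- L] position_weights.
Proof.
move=> L1 L2 eqL.
have position (js : seq 'I_n) : perm_eq js (enum 'I_n) ->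
    exists2 s : 'I_n -> 'I_n, injective s & forall j, s j = index j js :> nat.
  move=> js_enum; have js_mem j : j \in js by rewrite (perm_mem js_enum) mem_enum.
  have lt j : (index j js < n)%N.
    by rewrite -{2}(size_enum_ord n) -(perm_size js_enum) index_mem.
  exists (fun j => Ordinal (lt j)) => // j k [].
  by apply: index_inj => //; apply: js_mem.
have [s s_inj sE] := position _ L1; have [t t_inj tE] := position _ L2.
exists (\matrix_(i, j) (i == s j), \matrix_(i, j) (i == t j)).
  apply/and3P; split; try exact: position_assignment.
  apply/forallP => i; apply/forall_inP => j jM; rewrite !mxE.
  rewrite (_ : s j = t j) //; apply: val_inj => /=; rewrite sE tE.
  by apply: index_unzip => ab abL; apply: eqL.
rewrite /cost (@sum_completion_position _ _ s); last by move=> i j; rewrite mxE.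
rewrite (@sum_completion_position _ _ t); last by move=> i j; rewrite mxE.
rewrite /position_weight; under eq_bigr do rewrite sE.
under [X in _ + X]eq_bigr do rewrite tE.
rewrite !sum_index_weight // -dotseqDl ?size_map //.
by rewrite /unzip1 /unzip2 -!map_comp zip_map -map_comp.
Qed.

Lemma opt_attained p q M :
  exists2 xy, feasible M xy
    & cost p q xy = dotseq (merged_sorted p q M) position_weights.
Proof.
pose sorted_by (f : 'I_n -> R) := sort (relpre f <=%R) (enum (~: M)).
(* Zipping [J p] with [J q] pairs each shared job with itself, and the job of k-th smallest [p]
   outside [M] with that of k-th smallest [q]. *)
pose J f := enum M ++ sorted_by f.
have szC : size (sorted_by p) = size (sorted_by q) by rewrite !size_sort.
have szJ : size (J p) = size (J q) by rewrite !size_cat szC.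
pose key ab := p ab.1 + q ab.2.
(* Composite jobs are scheduled by non-decreasing total time, the shortest receiving the largest
   weight. *)
pose L := sort (relpre key <=%R) (zip (J p) (J q)).
have permL : perm_eq L (zip (J p) (J q)) by rewrite perm_sort.
have permJ f : perm_eq (J f) (enum 'I_n).
  apply: perm_trans (perm_enum_setC M).
  by rewrite perm_cat2l perm_sort.
have [|||xy Fxy cost_xy] := @feasible_of_pairs p q M L.
- apply: perm_trans (permJ p).
  by rewrite -(@unzip1_zip _ _ (J p) (J q)) ?szJ // perm_map.
- apply: perm_trans (permJ q).
  by rewrite -(@unzip2_zip _ _ (J p) (J q)) ?szJ // perm_map.
- move=> [a b] j; rewrite (perm_mem permL) zip_cat // mem_cat => /orP[] abz jM /=.
    by move: abz; rewrite -[enum M]map_id zip_map => /mapP[k _ [-> ->]].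
  (* In the remaining case both components lie outside [M], so neither is the shared job [j]. *)
  have /= := map_f fst abz; rewrite -/(unzip1 _) unzip1_zip ?szC // mem_sort mem_enum inE.
  have /= := map_f snd abz; rewrite -/(unzip2 _) unzip2_zip ?szC // mem_sort mem_enum inE.
  move=> bM aM; have [aj|_] := eqVneq a j; first by rewrite aj jM in aM.
  by have [bj|] := eqVneq b j; first by rewrite bj jM in bM.
exists xy; rewrite // cost_xy; congr dotseq.
rewrite /L -sort_map /merged_sorted zip_cat // map_cat; congr (sort _ (_ ++ _)).
  by rewrite -[in LHS](map_id (enum M)) zip_map -map_comp.
rewrite /unshared_sums /unshared_sorted !sort_map -/(sorted_by p) -/(sorted_by q).
by elim: (sorted_by p) (sorted_by q) => [|a u IH] [|b v] //=; rewrite IH.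
Qed.

End Assignments.

Theorem theorem1 (R : realDomainType) (n : nat) (p q : 'I_n -> R)
    (M : {set 'I_n})
    (p_ge0 : forall j, 0 <= p j) (q_ge0 : forall j, 0 <= q j) :
  opt_value p q M = \sum_(i < n) (n - i)%:R * (merged_sorted p q M)`_i.
Proof.
rewrite (dotseq_nth (@position_weight R n)) ?size_merged_sorted //.
have [[xy Fxy opt_xy] opt_min] := opt_valueP p q M.
have [xy' Fxy' cost_xy'] := opt_attained p q M.
by apply/le_anti; rewrite -{1}cost_xy' opt_min //= opt_xy cost_ge.
Qed.
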